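(* Let $\mathcal V \subset \Sigma^+$ be a finite vocabulary, let $\mathcal T$ be a deterministic finite-state transducer (the lexer) with finite state set $Q$, input alphabet $\Sigma$ and output alphabet $\Gamma$, and let $\mathcal P$ be a terminating deterministic push-down automaton (the parser) with input alphabet $\Gamma$ and stack alphabet $\Pi$. For $q\in Q$ and $v\in\mathcal V$ let $R_q(v)\subseteq\Gamma^*$ be the finite set of realizable terminal sequences of $v$ from $q$. Then for every token $v \in \mathcal V$, the set of all (lexer state, parser stack) pairs that accept $v$, encoded as words $q\alpha$ over the finite alphabet $Q \sqcup \Pi$, namely $$\{\, q\alpha \;:\; q\in Q,\ \alpha\in\Pi^+,\ \exists w\in R_q(v)\ \exists \beta\in\Pi^+ \text{ stable with } \alpha \to^*_{w} \beta \text{ in } \mathcal P \,\},$$ is a regular language.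
   Context: All alphabets and state sets are finite. $\varepsilon$ is the empty string; $A_\varepsilon = A\cup\{\varepsilon\}$; $A^+=A^*\setminus\{\varepsilon\}$; $AB$ denotes concatenation of languages. Finite-state transducer (FST). An FST $\mathcal T$ consists of a finite state set $Q$, input alphabet $\Sigma$, output alphabet $\Gamma$, start state $q_0\in Q$, final states $F\subseteq Q$, and a finite set of transitions $\delta: Q\times\Sigma_\varepsilon\to 2^{\Gamma^*\times Q}$. A transition $(y,q')\in\delta(q,a)$ is written $q\to_{a:y}q'$; consecutive transitions concatenate input and output labels and are written $q\to^*_{s:x}q'$ (with $q\to^*_{\varepsilon:\varepsilon}q$). $\mathcal T$ is deterministic if for every $q\in Q$ either ($|\delta(q,a)|\le 1$ for all $a\in\Sigma$ and $\delta(q,\varepsilon)=\varnothing$) or ($\delta(q,a)=\varnothing$ for all $a\in\Sigma$ and $|\delta(q,\varepsilon)|=1$). A state $q$ is stable if $\delta(q,\varepsilon)=\varnothing$. For $W\subseteq\Sigma^*$, $\mathcal T_q(W)=\{x\in\Gamma^* : \exists s\in W, \exists q'\in F,\ q\to^*_{s:x}q'\}$, and $\mathcal T(W)=\mathcal T_{q_0}(W)$. Realizable terminal sequences. Each lexer state $p$ comes with a finite set $T_p\subset\Gamma^*$ (the possible terminal prefixes from $p$) such that $\mathcal T_p(\Sigma^* )=T_p\,\mathcal T(\Sigma^* )$. For $q\in Q$, $v\in\mathcal V$: if $q\to^*_{v:x}p$ with $p$ stable (such $x,p$ are unique by determinism), then $R_q(v)=xT_p$; if there is no such $p$, $R_q(v)=\varnothing$.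 Push-down automaton (PDA). A PDA $\mathcal P$ consists of an input alphabet $\Gamma$, a stack alphabet $\Pi$, an initial stack $\gamma_0\in\Pi^2$, a set of final symbols $F\subseteq\Pi$, and a finite set of transitions $\delta:\Pi^2\times\Gamma_\varepsilon\to 2^{\Pi^+}$. Configurations are stacks in $\Pi^+$, written with the top of the stack first (the top symbol plays the role of the control state). If $\beta\in\delta(\alpha,a)$ then $\alpha\gamma\to_a\beta\gamma$ for every $\gamma\in\Pi^*$. $\alpha\to^*_w\beta$ means that $\beta$ is reached from $\alpha$ by finitely many (possibly zero) transitions whose labels in $\Gamma_\varepsilon$ concatenate to $w\in\Gamma^*$. $\mathcal P$ is deterministic if for every $\alpha\in\Pi^2$ either ($|\delta(\alpha,a)|\le1$ for all $a\in\Gamma$ and $\delta(\alpha,\varepsilon)=\varnothing$) or ($\delta(\alpha,a)=\varnothing$ for all $a\in\Gamma$ and $|\delta(\alpha,\varepsilon)|=1$). A deterministic PDA is terminating if from no stack is there an infinite sequence of $\varepsilon$-transitions. A stack $\beta=\beta_1\cdots\beta_n\in\Pi^+$ is stable if $\beta_1\in F$, or $n\ge 2$ and $\delta(\beta_1\beta_2,a)\ne\varnothing$ for some $a\in\Gamma$. A pair $(q,\alpha)\in Q\times\Pi^+$ accepts the token $v$ if there are $w\in R_q(v)$ and a stable $\beta\in\Pi^+$ with $\alpha\to^*_w\beta$. *)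

(* Defs.v *)
From mathcomp Require Import all_boot.
From mathcomp Require Import finmap.

Set Implicit Arguments.
Unset Strict Implicit.
Unset Printing Implicit Defensive.

Local Open Scope fset_scope.

Definition language (A : Type) : Type := seq A -> Prop.

Definition lang_all (A : Type) : language A := fun _ => True.

Definition lang_cat (A : Type) (K L : language A) : language A :=
  fun x => exists y z : seq A, [/\ K y, L z & x = y ++ z].

(* A set A_eps is rendered as option A, with None for the empty string. *)
Definition ocons (A : Type) (o : option A) (s : seq A) : seq A :=
  if o is Some a then a :: s else s.

Record dfa (A : finType) := Dfa {
  dfa_state : finType;
  dfa_start : dfa_state;
  dfa_final : {set dfa_state};
  dfa_trans : dfa_state -> A -> dfa_state }.

Definition dfa_accepts (A : finType) (M : dfa A) (u : seq A) : bool :=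
  foldl (@dfa_trans A M) (dfa_start M) u \in dfa_final M.

Definition regular (A : finType) (L : language A) : Prop :=
  exists M : dfa A, forall u : seq A, dfa_accepts M u <-> L u.

Record transducer (Q S G : finType) := Transducer {
  tr_start : Q;
  tr_final : {set Q};
  tr_delta : Q -> option S -> {fset (seq G * Q)} }.

Section Transducer.
Variables (Q S G : finType) (T : transducer Q S G).

(* tr_run q s x q' : the state q' is reached from q reading s, writing x. *)
Inductive tr_run : Q -> seq S -> seq G -> Q -> Prop :=
| tr_run_nil q : tr_run q [::] [::] q
| tr_run_step q (o : option S) (y : seq G) q1 s x q2 :
    (y, q1) \in tr_delta T q o -> tr_run q1 s x q2 ->
    tr_run q (ocons o s) (y ++ x) q2.

Definition tr_deterministic : Prop :=
  forall q : Q,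
    ((forall a : S, #|` tr_delta T q (Some a)| <= 1)
       /\ tr_delta T q None = fset0)
    \/ ((forall a : S, tr_delta T q (Some a) = fset0)
       /\ #|` tr_delta T q None| = 1).

Definition tr_stable (q : Q) : Prop := tr_delta T q None = fset0.

Definition tr_image_from (q : Q) (W : language S) : language G :=
  fun x => exists (s : seq S) (q' : Q),
    [/\ W s, q' \in tr_final T & tr_run q s x q'].

Definition tr_image (W : language S) : language G :=
  tr_image_from (tr_start T) W.

Definition terminal_prefixes (Tp : Q -> {fset (seq G)}) : Prop :=
  forall (p : Q) (x : seq G),
    tr_image_from p (@lang_all S) x
    <-> lang_cat (fun t => t \in Tp p) (tr_image (@lang_all S)) x.

(* When T is deterministic at most one pair (x, p) qualifies, so this is
   x T_p if that pair exists and the empty set otherwise. *)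
Definition realizable (Tp : Q -> {fset (seq G)}) (q : Q) (v : seq S) :
    language G :=
  fun w => exists (x : seq G) (p : Q) (t : seq G),
    [/\ tr_run q v x p, tr_stable p, t \in Tp p & w = x ++ t].

End Transducer.

(* Stacks are sequences with the top symbol first. *)
Record pda (G P : finType) := Pda {
  pda_init : P * P;
  pda_final : {set P};
  pda_delta : P * P -> option G -> {fset (seq P)};
  pda_delta_nonempty : forall ab o, [::] \notin pda_delta ab o }.

Section Pda.
Variables (G P : finType) (A : pda G P).

Inductive pda_step : option G -> seq P -> seq P -> Prop :=
| pda_step_intro (o : option G) (a1 a2 : P) (b g : seq P) :
    b \in pda_delta A (a1, a2) o -> pda_step o [:: a1, a2 & g] (b ++ g).

Inductive pda_run : seq P -> seq G -> seq P -> Prop :=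
| pda_run_nil a : pda_run a [::] a
| pda_run_step a (o : option G) a1 w b :
    pda_step o a a1 -> pda_run a1 w b -> pda_run a (ocons o w) b.

Definition pda_deterministic : Prop :=
  forall ab : P * P,
    ((forall c : G, #|` pda_delta A ab (Some c)| <= 1)
       /\ pda_delta A ab None = fset0)
    \/ ((forall c : G, pda_delta A ab (Some c) = fset0)
       /\ #|` pda_delta A ab None| = 1).

Definition pda_terminating : Prop :=
  ~ exists f : nat -> seq P, forall n : nat, pda_step None (f n) (f n.+1).

Definition pda_stable (b : seq P) : Prop :=
  match b with
  | [::] => False
  | b1 :: b' =>
      b1 \in pda_final A
      \/ (if b' is b2 :: _
          then exists c : G, pda_delta A (b1, b2) (Some c) <> fset0
          else False)
  end.

End Pda.

Definition pair_accepts (Q S G P : finType) (T : transducer Q S G)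
    (A : pda G P) (Tp : Q -> {fset (seq G)}) (q : Q) (a : seq P)
    (v : seq S) : Prop :=
  exists w : seq G, realizable T Tp q v w
    /\ exists b : seq P, [/\ b != [::], pda_stable A b & pda_run A a w b].

Definition accepting_pairs (Q S G P : finType) (T : transducer Q S G)
    (A : pda G P) (Tp : Q -> {fset (seq G)}) (v : seq S) :
    language (Q + P)%type :=
  fun u => exists (q : Q) (a : seq P),
    [/\ a != [::], u = inl q :: map inr a & pair_accepts T A Tp q a v].

(* Main.v *)
Require Import Defs.
From mathcomp Require Import all_boot.
From mathcomp Require Import finmap.
From mathcomp Require Import boolp.

(** The language has finitely many residuals.  A run of the parser from the
stack [al ++ ga] either never looks below [al], or at some point shrinks [al]
to a single symbol [a], after which it depends only on [a], on [ga] and on the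
terminals still to be read.  Since the realizable sequences of a token have
bounded length, the residual of a word [q al] is determined by whether the
word is accepted and by the finite set of pairs (symbol, remaining terminals)
that arise in this way. *)

Set Implicit Arguments.
Unset Strict Implicit.
Unset Printing Implicit Defensive.

(* The summary [f] need not be compatible with appending a letter: the
automaton restarts from a chosen representative of its current state. *)
Lemma regular_of_residuals (A X : finType) (L : language A) (f : seq A -> X) :
  (forall u u' z, f u = f u' -> L (u ++ z) -> L (u' ++ z)) -> regular L.
Proof.
move=> resL.
have [r rP] : {r : X -> seq A & forall x, (exists u, f u = x) -> f (r x) = x}.
  apply: (@choice _ _ (fun x u => (exists u', f u' = x) -> f u = x)) => x.
  have [[u fu]|no_u] := pselect (exists u, f u = x); first by exists u.
  by exists [::] => /no_u.
pose M := @Dfa A X (f [::]) [set x | `[< L (r x) >]]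
               (fun x a => f (rcons (r x) a)).
pose run := foldl (@dfa_trans A M) (dfa_start M).
have f_r u : f (r (f u)) = f u by apply: rP; exists u.
(* [run u] may differ from [f u]; the invariant is only that the word chosen for [run u] has the
   same residual as [u]. *)
have runP u z : L (r (run u) ++ z) <-> L (u ++ z).
  elim/last_ind: u z => [|u a IHu] z.
    by split; apply: resL; rewrite /run /= f_r.
  rewrite /run foldl_rcons -/(run u) cat_rcons -IHu -cat_rcons /=.
  by split; apply: resL; rewrite f_r.
exists M => u; have := runP u [::]; rewrite !cats0 => <-.
by rewrite /dfa_accepts -/(run u) inE; split=> /asboolP.
Qed.

Lemma cardfs_le1_eq (K : choiceType) (B : {fset K}) b c :
  #|` B| <= 1 -> b \in B -> c \in B -> b = c.
Proof.
move=> leB1 bB cB; apply/eqP; apply: contraTT leB1 => neq_bc.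
rewrite -ltnNge; have <- : #|` [fset b; c]%fset| = 2 by rewrite cardfs2 neq_bc.
by apply/fsubset_leq_card/fsubsetP => d; rewrite !inE => /orP[] /eqP->.
Qed.

Section TransducerRuns.
Variables (Q S G : finType) (T : transducer Q S G).
Hypothesis detT : tr_deterministic T.

(** A deterministic state has either a single empty-input transition or none and at most one per
    symbol, so the input leaves no choice. *)
Lemma tr_delta_uniq q o o' s s' z z' :
  z \in tr_delta T q o -> z' \in tr_delta T q o' -> ocons o s = ocons o' s' ->
  [/\ o = o', s = s' & z = z'].
Proof.
have [[le1 eps]|[sym eps]] := detT q; case: o o' => [a|] [a'|] /=;
  rewrite ?eps ?sym ?in_fset0 // => dz dz'.
  by case=> eqa <-; rewrite -eqa in dz' *; rewrite (cardfs_le1_eq _ dz dz').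
by move=> <-; rewrite (cardfs_le1_eq _ dz dz') // eps.
Qed.

(** Two runs on the same input could differ only if one went on with empty-input transitions, and a
    stable state has none. *)
Lemma tr_run_stable_uniq q v x p x' p' :
  tr_run T q v x p -> tr_stable T p -> tr_run T q v x' p' -> tr_stable T p' ->
  x = x' /\ p = p'.
Proof.
move=> run_p; elim: run_p x' p' => {q v x p} [q|q o y q1 s x p dq _ IH] x' p' stp.
  move Ev: [::] => v run'; case: run' Ev stp => // {}q [] //= y q1 s x p + _ _.
  by move=> + stq; rewrite stq in_fset0.
move Ev: (ocons o s) => v run'.
case: run' Ev dq => {q v x' p'} [q|q o' y' q1' s' x' p' dq' run'] Ev dq stp'.
  by case: o Ev dq => //= _; rewrite stp' in_fset0.
have [_ eqs [<- eqq]] := tr_delta_uniq dq dq' Ev.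
by rewrite -eqs -eqq in run'; have [-> ->] := IH _ _ stp run' stp'.
Qed.

(** For each [q] these sequences are [x ++ t] with one fixed [x] and [t] in one finite set; the
    maximum over all states gives [n]. *)
Lemma realizable_bounded (Tp : Q -> {fset (seq G)}) v :
  exists n, forall q w, realizable T Tp q v w -> size w <= n.
Proof.
have [n nP] : {n : Q -> nat & forall q w, realizable T Tp q v w -> size w <= n q}.
  apply: (@choice _ _ (fun q n => forall w, realizable T Tp q v w -> size w <= n)).
  move=> q; have [[x [p [run_p stp]]]|no_run] :=
    pselect (exists x p, tr_run T q v x p /\ tr_stable T p); last first.
    by exists 0 => w [x [p [t [run_p stp _ _]]]]; case: no_run; exists x, p.
  exists (size x + \max_(t <- Tp p) size t) => w [x' [p' [t [run' stp' tp ->]]]].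
  have [-> eqp] := tr_run_stable_uniq run_p stp run' stp'.
  by rewrite size_cat leq_add2l leq_bigmax_seq // eqp.
by exists (\max_q n q) => q w /nP/leq_trans; apply; apply: leq_bigmax.
Qed.

End TransducerRuns.

Section PdaRuns.
Variables (G P : finType) (A : pda G P).

Lemma pda_run_cat a w1 b w2 c :
  pda_run A a w1 b -> pda_run A b w2 c -> pda_run A a (w1 ++ w2) c.
Proof.
elim=> // {a w1 b} a o a1 w b step _ IH run_c.
have -> : ocons o w ++ w2 = ocons o (w ++ w2) by case: o {step}.
exact: pda_run_step step (IH run_c).
Qed.

Lemma pda_run_below a w b c :
  pda_run A a w b -> pda_run A (a ++ c) w (b ++ c).
Proof.
elim=> [{}a|{w b} _ o _ w b [{}o a1 a2 d g din] _ IH]; first exact: pda_run_nil.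
by apply: pda_run_step IH; rewrite -catA; apply: pda_step_intro.
Qed.

Lemma pda_stable_below b c : pda_stable A b -> pda_stable A (b ++ c).
Proof. by case: b => [|b1 [|b2 b]] //= [b1F|//]; left. Qed.

(** A transition pops two symbols and pushes at least one, so the part above [c] never vanishes:
    before [c] is touched, it has shrunk to one symbol. *)
Lemma pda_run_split a c w b :
  a != [::] -> pda_run A (a ++ c) w b ->
  (exists b', [/\ b' != [::], b = b' ++ c & pda_run A a w b']) \/
  (exists d w1 w2, [/\ w = w1 ++ w2, pda_run A a w1 [:: d]
                     & pda_run A (d :: c) w2 b]).
Proof.
move=> a_n0; move Es: (a ++ c) => s run_b.
elim: run_b a a_n0 Es => {s w b} [s|s o s1 w b step run_b IH] a a_n0 Es.
  by left; exists a; split=> //; exact: pda_run_nil.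
case: a a_n0 Es => // d [|d' a] _ Es.
  right; exists d, [::], (ocons o w); split=> //; first exact: pda_run_nil.
  by rewrite /= in Es; rewrite Es; exact: pda_run_step step run_b.
case: step Es IH => {s s1 run_b} {}o a1 a2 e g ein [Ed Ed' Eg] IH.
rewrite -{}Ed -{}Ed' in ein; rewrite -{}Eg in IH.
have step' : pda_step A o [:: d, d' & a] (e ++ a) by exact: pda_step_intro.
have ea_n0 : e ++ a != [::].
  by case: e ein {IH step'} => //; rewrite (negPf (pda_delta_nonempty _ _ _)).
have [|[b' [? ? run']]|[d1 [w1 [w2 [-> run1 run2]]]]] := IH _ ea_n0.
- by rewrite catA.
- by left; exists b'; split=> //; exact: pda_run_step step' run'.
right; exists d1, (ocons o w1), w2; split=> //; first by case: o {ein step'}.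
exact: pda_run_step step' run1.
Qed.

Definition pda_accepts a w :=
  exists b, [/\ b != [::], pda_stable A b & pda_run A a w b].

Lemma pda_accepts_below a c w : pda_accepts a w -> pda_accepts (a ++ c) w.
Proof.
case=> b [b_n0 stb run_b]; exists (b ++ c); split.
- by case: b b_n0 {stb run_b}.
- exact: pda_stable_below.
exact: pda_run_below.
Qed.

(** Stability of [b' ++ c] may depend on [c] when [b'] is a single symbol; that case goes to the
    second alternative, with [w2] empty. *)
Lemma pda_accepts_split a c w :
  a != [::] -> pda_accepts (a ++ c) w ->
  pda_accepts a w \/
  exists d w1 w2, [/\ w = w1 ++ w2, pda_run A a w1 [:: d]
                    & pda_accepts (d :: c) w2].
Proof.
move=> a_n0 [b [b_n0 stb /(pda_run_split a_n0)]].
case=> [[b' [b'_n0 eqb run_b']]|[d [w1 [w2 [-> run1 run2]]]]]; last first.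
  by right; exists d, w1, w2; split=> //; exists b.
case: b' b'_n0 eqb run_b' => [|d [|d' b']] // _ eqb run_b'.
  right; exists d, w, [::]; rewrite cats0; split=> //.
  by exists b; rewrite eqb; split=> //; [rewrite -eqb|exact: pda_run_nil].
by left; exists [:: d, d' & b']; split=> //; rewrite eqb in stb.
Qed.

End PdaRuns.

Lemma pair_shape_cat (Q P : eqType) (q : Q) (a : seq P) u z :
  1 < size u -> u ++ z = inl q :: map inr a ->
  exists a1 a2, [/\ a1 != [::], a = a1 ++ a2, u = inl q :: map inr a1
                  & z = map inr a2].
Proof.
case: u => // e u; rewrite /= ltnS => u_gt0 [-> Euz].
have Ea : a = take (size u) a ++ drop (size u) a by rewrite cat_take_drop.
have Esz : size (take (size u) a) = size u.
  rewrite size_takel // -(size_map (@inr Q P) a) -Euz size_cat; exact: leq_addr.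
exists (take (size u) a), (drop (size u) a); split=> //.
- by rewrite -size_eq0 Esz -lt0n.
- by rewrite map_take -Euz take_size_cat.
by rewrite map_drop -Euz drop_size_cat.
Qed.

Theorem theorem3 (Sigma Gamma Q Pi : finType)
    (V : {fset (seq Sigma)}) (hV : forall v : seq Sigma, v \in V -> v != [::])
    (T : transducer Q Sigma Gamma) (hT : tr_deterministic T)
    (P : pda Gamma Pi) (hPdet : pda_deterministic P)
    (hPterm : pda_terminating P)
    (Tp : Q -> {fset (seq Gamma)}) (hTp : terminal_prefixes T Tp) :
  forall v : seq Sigma, v \in V -> regular (accepting_pairs T P Tp v).
Proof.
move=> v _; have [n bound] := realizable_bounded hT Tp v.
set L := accepting_pairs T P Tp v.
(* Since [ds.2] is a suffix of a realizable sequence, length at most [n] suffices, and [ds] ranges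
   over a finite type. *)
pose residual u (ds : Pi * n.-bseq Gamma) := exists q a w1,
  [/\ a != [::], u = inl q :: map inr a, realizable T Tp q v (w1 ++ ds.2)
    & pda_run P a w1 [:: ds.1]].
(* Words of at most one letter have no stack part to run from after a state; [ohead] records them
   exactly. *)
pose f u := (if size u <= 1 then Some (ohead u) else None,
             [set ds | `[< residual u ds >]], `[< L u >]).
apply: (regular_of_residuals (f := f)) => u u' z [].
case: leqP => [u1|u2]; case: leqP => // u'_sz.
  by case: u u1 => [|x []] //; case: u' u'_sz => [|x' []] //= _ _ [->].
move=> _ /setP eq_res eqL [q [a [a_n0 Ea [w [Rw acc_w]]]]].
have [a1 [a2 [a1_n0 Ea12 Eu Ez]]] := pair_shape_cat u2 Ea.
rewrite Ea12 in acc_w.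
have [acc1|[d [w1 [w2 [Ew run1 acc2]]]]] := pda_accepts_split a1_n0 acc_w.
  (* The run never needs [a2]: [u] itself is accepted, hence so is [u'], and [a2] is put below its
     stack. *)
  have : `[< L u >] by apply/asboolP; exists q, a1; split=> //; exists w.
  rewrite eqL => /asboolP[q' [a' [a'_n0 -> [w' [Rw' acc']]]]].
  exists q', (a' ++ a2); split; first by case: a' a'_n0 {acc'}.
    by rewrite map_cat Ez.
  by exists w'; split=> //; exact: pda_accepts_below.
have w2n : size w2 <= n.
  by apply: leq_trans (bound q w Rw); rewrite Ew size_cat leq_addl.
(* Equal summaries give [u'] a stack that also shrinks to [d] with [w2] left to read; the run from
   [d :: a2] is reused. *)
have : residual u (d, Bseq w2n) by exists q, a1, w1; split=> //=; rewrite -Ew.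
have := eq_res (d, Bseq w2n); rewrite !inE => eq_dw /asboolP.
rewrite eq_dw => /asboolP[q' [a' [w1' [a'_n0 -> Rw' run1']]]].
exists q', (a' ++ a2); split; first by case: a' a'_n0 {run1'}.
  by rewrite map_cat Ez.
exists (w1' ++ w2); split=> //; have [b [b_n0 stb run2]] := acc2.
by exists b; split=> //; exact: pda_run_cat (pda_run_below a2 run1') run2.
Qed.
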